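(* Let $B$ be a compact Hausdorff space that is not discrete. Assume $M\subset C(B)$ is a Haar space of dimension $n$, $n\ge2$. Then $$\inf_{f\in C(B),\ \|f\|=1}\gamma(f)=0.$$
   Context: $C(B)$ is the space of continuous real-valued functions on $B$ with the uniform norm $\|f\|=\max_{x\in B}|f(x)|$. An $n$-dimensional subspace $M$ of $C(B)$ is a Haar space if no nontrivial $m\in M$ vanishes at more than $n-1$ distinct points of $B$. In that case each $f\in C(B)$ has a unique best approximant $m^*$ from $M$, and $\gamma(f)$ denotes the optimal (largest) strong uniqueness constant of $f$, i.e. the largest $\gamma$ such that $\|f-m\|-\|f-m^*\|\ge\gamma\|m-m^*\|$ for all $m\in M$; equivalently $\gamma(f)=\inf_{m\in M,\,m\ne m^*}\frac{\|f-m\|-\|f-m^*\|}{\|m-m^*\|}$. *)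

(* Defs.v *)
From HB Require Import structures.
From mathcomp Require Import all_boot all_order all_algebra.
From mathcomp Require Import all_classical all_reals all_analysis.
Import numFieldNormedType.Exports.

Set Implicit Arguments.
Unset Strict Implicit.
Unset Printing Implicit Defensive.

Import Order.TTheory GRing.Theory Num.Theory.

Local Open Scope classical_set_scope.
Local Open Scope ring_scope.

Definition is_discrete (B : topologicalType) : Prop :=
  forall A : set B, open A.

Definition continuous_functions (R : realType) (B : topologicalType) :
    set (B -> R) :=
  [set f | continuous f].
Arguments continuous_functions : clear implicits.

(** For continuous [f] on a nonempty compact [B] the supremum is attained. *)
Definition uniform_norm (R : realType) (B : topologicalType) (f : B -> R) : R :=
  sup (range (fun x => `|f x|)).

Definition linear_independent (R : realType) (B : topologicalType) (n : nat)
    (e : 'I_n -> (B -> R)) : Prop :=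
  forall c : 'I_n -> R, \sum_(i < n) c i *: e i = 0 -> forall i, c i = 0.

Definition linear_span (R : realType) (B : topologicalType) (n : nat)
    (e : 'I_n -> (B -> R)) : set (B -> R) :=
  [set m | exists c : 'I_n -> R, m = \sum_(i < n) c i *: e i].

Definition subspace_of_dim (R : realType) (B : topologicalType)
    (M : set (B -> R)) (n : nat) : Prop :=
  exists e : 'I_n -> (B -> R), linear_independent e /\ M = linear_span e.

Definition haar_space (R : realType) (B : topologicalType)
    (M : set (B -> R)) (n : nat) : Prop :=
  [/\ M `<=` continuous_functions R B,
      subspace_of_dim M n &
      forall m, M m -> m <> 0 ->
        forall s : seq B, uniq s -> (forall x, x \in s -> m x = 0) ->
          (size s <= n - 1)%N].

Definition is_best_approximant (R : realType) (B : topologicalType)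
    (M : set (B -> R)) (f m : B -> R) : Prop :=
  M m /\ forall p, M p -> uniform_norm (f - m) <= uniform_norm (f - p).

(** The default value [0] is returned only if [f] has no best approximant,
    which does not happen when [M] is a Haar space and [f] is continuous. *)
Definition best_approximant (R : realType) (B : topologicalType)
    (M : set (B -> R)) (f : B -> R) : B -> R :=
  xget 0 [set m | is_best_approximant M f m].

(** The optimal strong uniqueness constant, as an infimum in the extended
    reals; it is finite as soon as [M] is not reduced to one point. *)
Definition strong_uniqueness_constant (R : realType) (B : topologicalType)
    (M : set (B -> R)) (f : B -> R) : \bar R :=
  let ms := best_approximant M f in
  ereal_inf
    [set ((uniform_norm (f - m) - uniform_norm (f - ms))
           / uniform_norm (m - ms))%:E | m in [set m | M m /\ m <> ms]].

(* Main.v *)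
Require Import Defs.
From HB Require Import structures.
From mathcomp Require Import all_boot all_order all_algebra.
From mathcomp Require Import all_classical all_reals all_analysis.
From mathcomp Require Import lra.

Set Implicit Arguments.
Unset Strict Implicit.
Unset Printing Implicit Defensive.

Import Order.TTheory GRing.Theory Num.Theory.
Import numFieldNormedType.Exports.

Local Open Scope classical_set_scope.
Local Open Scope ring_scope.

(** Let [p] be a non-isolated point and let [m] in [M], of norm 1, vanish at [p]
    and at [n - 2] further points.  Add a point [y] so close to [p] that
    [|m y| <= eps], and a last point [z].  Up to scaling, [M] satisfies a single
    linear relation [\sum lambda x * m x = 0] on these [n + 1] points, and all its
    coefficients are nonzero.  Any [f] of norm 1 with [f x = sg (lambda x)] at
    these points has [0] as its unique best approximant.  After a choice of sign
    for [m], the prescribed values are compatible with [|f - m| <= 1 + eps], so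
    such an [f] is obtained by clamping, and its constant is at most [eps]. *)

(** * The uniform norm on a compact space *)

Lemma has_ubound_range_norm (R : realType) (B : topologicalType) (f : B -> R) :
  compact [set: B] -> continuous f -> has_ubound (range (fun x => `|f x|)).
Proof.
move=> cB cf.
have cfB : compact (f @` [set: B]).
  by apply: continuous_compact => //; exact: continuous_subspaceT.
have [N [Nr NP]] := compact_bounded cfB.
exists (N + 1) => _ [x _ <-]; apply: (NP (N + 1)); first by rewrite ltrDl.
by exists x.
Qed.

Lemma ler_uniform_norm (R : realType) (B : topologicalType) (f : B -> R) x :
  compact [set: B] -> continuous f -> `|f x| <= uniform_norm f.
Proof.
move=> cB cf; apply: ub_le_sup; first exact: has_ubound_range_norm.
by exists x.
Qed.

Lemma uniform_norm_le (R : realType) (B : topologicalType) (f : B -> R) K :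
  0 <= K -> (forall x, `|f x| <= K) -> uniform_norm f <= K.
Proof.
(* If [B] is empty, the norm is the supremum of the empty set, which is [0] by convention; this is
   where [0 <= K] matters. *)
move=> K0 fK; have [e|/set0P ne] := eqVneq (range (fun x => `|f x|)) set0.
  by rewrite /uniform_norm e sup0.
by apply: ge_sup => // _ [x _ <-].
Qed.

Lemma uniform_norm_ge0 (R : realType) (B : topologicalType) (f : B -> R) :
  compact [set: B] -> continuous f -> 0 <= uniform_norm f.
Proof.
move=> cB cf; have [e|/set0P[_ [x _ _]]] := eqVneq (range (fun x => `|f x|)) set0.
  by rewrite /uniform_norm e sup0.
exact: le_trans (ler_uniform_norm x cB cf).
Qed.

Lemma uniform_normZ (R : realType) (B : topologicalType) (a : R) (f : B -> R) :
  compact [set: B] -> continuous f -> a != 0 ->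
  uniform_norm (a *: f) = `|a| * uniform_norm f.
Proof.
move=> cB cf a0.
have le b (g : B -> R) : continuous g ->
    uniform_norm (b *: g) <= `|b| * uniform_norm g.
  move=> cg; apply: uniform_norm_le => [|x].
    by rewrite mulr_ge0 ?uniform_norm_ge0.
  have -> : (b *: g) x = b * g x by [].
  by rewrite normrM ler_wpM2l// ler_uniform_norm.
(* The reverse inequality is [le] applied to [a^-1] and [a *: f]. *)
apply/eqP; rewrite eq_le le//= mulrC -ler_pdivlMr ?normr_gt0//.
have caf : continuous (a *: f).
  by move=> x; apply: cvgM; [exact: cvg_cst|exact: cf].
have := le a^-1 _ caf.
by rewrite scalerA mulVf// scale1r normfV mulrC.
Qed.

Lemma uniform_norm_gt0 (R : realType) (B : topologicalType) (f : B -> R) :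
  compact [set: B] -> continuous f -> f <> 0 -> 0 < uniform_norm f.
Proof.
move=> cB cf f0; rewrite lt0r uniform_norm_ge0// andbT; apply/eqP => n0.
apply: f0; apply/funext => x; apply/eqP; rewrite -normr_le0 -n0.
exact: ler_uniform_norm.
Qed.

(** * Choice of points and interpolation of signs *)

Lemma non_isolated_point (B : topologicalType) :
  ~ is_discrete B -> exists p : B, ~ open [set p].
Proof.
move=> nd; apply: contrapT => /forallNP H; apply: nd => A.
rewrite -[A]image_id -bigcup_imset1; apply: bigcup_open => x _.
exact: contrapT (H x).
Qed.

(** Otherwise [[set p]] would be the interior of [U] with the points of [s] other than [p] removed.
    That set is open, since finite sets are closed in a Hausdorff space. *)
Lemma nbhs_fresh_point (B : topologicalType) (p : B) (U : set B) (s : seq B) :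
  hausdorff_space B -> ~ open [set p] -> nbhs p U ->
  exists2 y, U y & y \notin s.
Proof.
move=> hB np Up; apply: contrapT => H; apply: np.
have oF : open (~` [set x | x \in s /\ x != p]).
  apply: closed_openC.
  apply: (accessible_finite_set_closed.1 (hausdorff_accessible hB)).
  by apply: (@sub_finite_set _ _ [set` s]) => //= x [].
have -> : [set p] = U^° `&` ~` [set x | x \in s /\ x != p].
  apply/seteqP; split => [x ->|x [Ux nsx]]; first by split => //= -[_]; rewrite eqxx.
  apply: contrapT => xp; apply: H; exists x; first exact: interior_subset.
  by apply/negP => xs; apply: nsx; split => //; apply/eqP.
by apply: openI => //; exact: open_interior.
Qed.

Lemma uniq_seq_of_size (B : topologicalType) (p : B) (s : seq B) k :
  hausdorff_space B -> ~ open [set p] -> uniq s ->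
  exists t, uniq (t ++ s) /\ size t = k.
Proof.
move=> hB np us; elim: k => [|k [t [ut st]]]; first by exists [::].
have [y _ yt] := nbhs_fresh_point (t ++ s) hB np filterT.
by exists (y :: t); rewrite /= st yt ut.
Qed.

(** The points of [s] with value [-1] and those with value [1] form disjoint finite, hence closed,
    sets. A compact Hausdorff space is normal, so a Urysohn function [u] separates them, and
    [2 * u - 1] takes the prescribed values. *)
Lemma continuous_sign_interpolation (R : realType) (B : topologicalType)
    (s : seq B) (sigma : B -> R) :
  compact [set: B] -> hausdorff_space B ->
  (forall x, x \in s -> `|sigma x| = 1) ->
  exists h : B -> R, continuous h /\ (forall x, x \in s -> h x = sigma x).
Proof.
move=> cB hB sigma1.
pose A b : set B := [set x | x \in s /\ sigma x = b].
have cA b : closed (A b).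
  apply: (accessible_finite_set_closed.1 (hausdorff_accessible hB)).
  by apply: (@sub_finite_set _ _ [set` s]) => //= x [].
have AA : A (-1) `&` A 1 = set0.
  by apply/seteqP; split => // x [[_ sx] [_]]; rewrite sx => /eqP; lra.
have /(_ _ _ (cA _) (cA _) AA) sep :=
  (@normal_separatorP R B).1 (compact_normal hB cB).
pose u : B -> R := Urysohn (A (-1)) (A 1).
exists (fun x => 2 * u x - 1); split.
  move=> x; apply: cvgB; last exact: cvg_cst.
  by apply: cvgM; [exact: cvg_cst|exact: Urysohn_continuous].
move=> x xs; have := sigma1 x xs.
have [s0|s0] := leP 0 (sigma x).
  rewrite ger0_norm// => s1.
  by rewrite (_ : u x = 1) ?s1; [lra|apply: (Urysohn_sub1 sep); exists x].
rewrite ltr0_norm// => s1; have {}s1 : sigma x = -1 by lra.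
by rewrite (_ : u x = 0) ?s1; [lra|apply: (Urysohn_sub0 sep); exists x].
Qed.

(** * Linear algebra in Haar spaces *)

Lemma left_kernel_vector (F : fieldType) (m n : nat) (A : 'M[F]_(m, n)) :
  (n < m)%N -> exists2 v : 'rV_m, v != 0 & v *m A = 0.
Proof.
move=> nm; have : kermx A != 0.
  rewrite -mxrank_eq0 mxrank_ker subn_eq0 -ltnNge.
  exact: leq_ltn_trans (rank_leq_col A) nm.
move=> /rowV0Pn[v vk v0]; exists v => //; exact/sub_kermxP.
Qed.

Lemma haar_space_continuous (R : realType) (B : topologicalType) (M : set (B -> R)) n m :
  haar_space M n -> M m -> continuous m.
Proof. by case=> + _ _ => /(_ m). Qed.

Lemma haar_space_scale (R : realType) (B : topologicalType) (M : set (B -> R)) n a m :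
  haar_space M n -> M m -> M (a *: m).
Proof.
case=> _ [e [_ ->]] _ [c ->]; exists (fun i => a * c i).
by rewrite scaler_sumr; apply: eq_bigr => i _; rewrite scalerA.
Qed.

Lemma haar_space_zero (R : realType) (B : topologicalType) (M : set (B -> R)) n :
  haar_space M n -> M 0.
Proof.
case=> _ [e [_ ->]] _; exists (fun=> 0).
by rewrite big1// => i _; rewrite scale0r.
Qed.

Lemma haar_eq0 (R : realType) (B : topologicalType) (M : set (B -> R)) n m
    (s : seq B) :
  haar_space M n -> M m -> (0 < n)%N -> uniq s -> (n <= size s)%N ->
  (forall x, x \in s -> m x = 0) -> m = 0.
Proof.
move=> [_ _ H] Mm n0 us ns m0; apply: contrapT => mn0.
have := H m Mm mn0 s us m0; rewrite leqNgt => /negP; apply.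
by rewrite subn1 prednK.
Qed.

Lemma lincomb_at (R : realType) (B : topologicalType) n (e : 'I_n -> B -> R)
    (c : 'I_n -> R) x : (\sum_i c i *: e i) x = \sum_i c i * e i x.
Proof. by rewrite fct_sumE. Qed.

(** Vanishing on [s] imposes fewer than [n] linear conditions on [n] coefficients; independence of
    the basis keeps a nontrivial solution nonzero as a function. *)
Lemma haar_space_vanishing (R : realType) (B : topologicalType) (M : set (B -> R)) n
    (s : seq B) :
  haar_space M n -> (size s < n)%N ->
  exists m, [/\ M m, m <> 0 & forall x, x \in s -> m x = 0].
Proof.
move=> [_ [e [ind ->]] _] sn.
have [v v0 vA] :=
  left_kernel_vector (\matrix_(i < n, j < size s) e i (tnth (in_tuple s) j)) sn.
exists (\sum_i v 0 i *: e i); split.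
- by exists (v 0).
- move=> /ind vi; move/eqP: v0; apply; apply/rowP => i.
  by rewrite mxE vi.
- move=> x /seq_tnthP[j ->]; rewrite lincomb_at.
  have /rowP/(_ j) := vA; rewrite !mxE => vAj; rewrite -[RHS]vAj.
  by apply: eq_bigr => i _; rewrite mxE.
Qed.

(* If two points [y], [x] of [s] had [lambda y = 0] and [lambda x <> 0], an
   element of [M] vanishing on the other [n - 1] points of [s] would also
   vanish at [x], hence be zero. *)
Lemma haar_annihilator (R : realType) (B : topologicalType) (M : set (B -> R))
    n (s : seq B) :
  haar_space M n -> (0 < n)%N -> uniq s -> size s = n.+1 ->
  exists lambda : B -> R,
    (forall m, M m -> \sum_(x <- s) lambda x * m x = 0) /\
    (forall x, x \in s -> lambda x != 0).
Proof.
move=> HM n0 us ss.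
have [lam [lamM [z zs lamz]]] : exists lambda : B -> R,
    (forall m, M m -> \sum_(x <- s) lambda x * m x = 0) /\
    (exists2 x, x \in s & lambda x != 0).
  have [_ [e [ind ->]] _] := HM.
  have ns : (n < size s)%N by rewrite ss.
  have [v v0 vA] :=
    left_kernel_vector (\matrix_(j < size s, i < n) e i (tnth (in_tuple s) j)) ns.
  have [j0 vj0] : exists j, v 0 j != 0.
    by apply/rV0Pn.
  (* A vector indexed by positions in [s] becomes a function on [B] through [idx]; the default [j0]
     is only reached outside [s]. *)
  pose idx x : 'I_(size s) := insubd j0 (index x s).
  have idxK j : idx (tnth (in_tuple s) j) = j.
    apply: val_inj; rewrite val_insubd (tnth_nth (tnth (in_tuple s) j0)) /=.
    by rewrite index_uniq // ltn_ord.
  exists (fun x => v 0 (idx x)); split; last first.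
    exists (tnth (in_tuple s) j0); last by rewrite idxK.
    by rewrite -[X in _ \in X]/(tval (in_tuple s)) mem_tnth.
  move=> _ [c ->]; rewrite big_tnth.
  under eq_bigr do rewrite idxK lincomb_at mulr_sumr.
  (* After the exchange, the factor of [c i] is the [i]-th entry of the product of [v] with the
     matrix, which is zero. *)
  rewrite exchange_big big1 // => i _.
  under eq_bigr do rewrite mulrCA.
  rewrite -mulr_sumr; have /rowP/(_ i) := vA; rewrite !mxE => vAi.
  rewrite [X in _ * X](_ : _ = 0) ?mulr0//.
  by rewrite -[RHS]vAi; apply: eq_bigr => j _; rewrite mxE.
exists lam; split => // y ys; apply/negP => /eqP lamy.
have yz : z != y by apply: contraNneq lamz => ->; rewrite lamy.
have zs' : z \in rem y s by rewrite mem_rem_uniq// inE yz.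
have st : size (rem z (rem y s)) = n.-1 by rewrite !size_rem// ss.
have [|m [Mm m0 mt]] := @haar_space_vanishing _ _ _ _ (rem z (rem y s)) HM.
  by rewrite st prednK.
have mz : m z = 0.
  have := lamM m Mm; rewrite (perm_big _ (perm_to_rem ys)) big_cons lamy mul0r /= add0r.
  rewrite (perm_big _ (perm_to_rem zs')) big_cons big_seq big1 /= ?addr0.
    by move=> /eqP; rewrite mulf_eq0 (negPf lamz) => /eqP.
  by move=> x xt; rewrite mt// mulr0.
apply: m0; apply: (haar_eq0 (s := rem y s) HM) => //.
- exact: rem_uniq.
- by rewrite size_rem// ss.
- move=> x xs; have [->//|xz] := eqVneq x z; apply: mt.
  by rewrite mem_rem_uniq ?rem_uniq// inE xz.
Qed.

(** * Coefficient bounds and existence of best approximants *)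

Lemma uniform_normD (R : realType) (B : topologicalType) (f g : B -> R) :
  compact [set: B] -> continuous f -> continuous g ->
  uniform_norm (f + g) <= uniform_norm f + uniform_norm g.
Proof.
move=> cB cf cg; apply: uniform_norm_le => [|x].
  by rewrite addr_ge0// uniform_norm_ge0.
by rewrite (le_trans (ler_normD _ _))// lerD// ler_uniform_norm.
Qed.

Lemma uniform_normN (R : realType) (B : topologicalType) (f : B -> R) :
  uniform_norm (- f) = uniform_norm f.
Proof.
rewrite /uniform_norm; congr sup; apply: eq_imagel => x _; exact: normrN.
Qed.

Lemma linear_span_basis (R : realType) (B : topologicalType) n (e : 'I_n -> B -> R) i :
  linear_span e (e i).
Proof.
exists (fun j => (j == i)%:R); rewrite (bigD1 i)//= eqxx scale1r.
by rewrite big1 ?addr0// => j /negPf ->; rewrite scale0r.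
Qed.

(* [c] is recovered from the values of [\sum_i c i *: e i] at [n] points by the
   inverse of the matrix of the values of [e] at these points. *)
Lemma haar_coefficient_bound (R : realType) (B : topologicalType) n
    (e : 'I_n -> B -> R) (p : B) :
  compact [set: B] -> hausdorff_space B -> ~ open [set p] -> (0 < n)%N ->
  haar_space (linear_span e) n -> linear_independent e ->
  exists2 K, 0 <= K & forall (c : 'I_n -> R) i,
    `|c i| <= K * uniform_norm (\sum_j c j *: e j).
Proof.
move=> cB hB np n0 HM ind.
have [t [ut st]] := uniq_seq_of_size n hB np (isT : uniq [::]).
rewrite cats0 in ut.
pose T : n.-tuple B := Tuple (introT eqP st).
pose A := \matrix_(i < n, j < n) e i (tnth T j).
have AE (c : 'I_n -> R) j :
    ((\row_i c i) *m A) 0 j = (\sum_i c i *: e i) (tnth T j).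
  by rewrite lincomb_at mxE; apply: eq_bigr => i _; rewrite !mxE.
(* A row killed by [A] gives an element of the span with [n] distinct zeros, so it is zero by the
   Haar property. *)
have Aunit : A \in unitmx.
  rewrite -row_free_unit; apply: inj_row_free => v vA.
  have /ind v0 : \sum_i v 0 i *: e i = 0.
    apply: (haar_eq0 (s := T) HM) => //; first by exists (v 0).
      by rewrite size_tuple.
    move=> x /tnthP[j ->]; rewrite -AE.
    rewrite (_ : \row_i v 0 i = v) ?vA ?mxE//.
    by apply/rowP => i; rewrite mxE.
  by apply/rowP => i; rewrite v0 mxE.
(* The sum over all entries of the inverse dominates each column sum, so one constant serves every
   [i]. *)
pose K := \sum_i \sum_j `|invmx A j i|.
have K0 : 0 <= K by apply: sumr_ge0 => i _; exact: sumr_ge0.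
exists K => // c i.
have cm : continuous (\sum_j c j *: e j : B -> R).
  by apply: (haar_space_continuous HM); exists c.
have -> : c i = ((\row_i c i) *m A *m invmx A) 0 i.
  by rewrite mulmxK// mxE.
rewrite mxE (le_trans (ler_norm_sum _ _ _))//.
apply: (@le_trans _ _ (\sum_j uniform_norm (\sum_j c j *: e j) * `|invmx A j i|)).
  by apply: ler_sum => j _; rewrite normrM AE ler_wpM2r// ler_uniform_norm.
rewrite -mulr_sumr mulrC ler_wpM2r ?uniform_norm_ge0//.
rewrite /K [leRHS](bigD1 i)//= lerDl; apply: sumr_ge0 => k _; exact: sumr_ge0.
Qed.

(** The distance to [f] is a continuous function of the coefficients, so it attains its minimum on a
    compact box. The box contains all coefficients of elements of norm at most twice that of [f];
    any other element approximates no better than [0]. *)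
Lemma haar_best_approximant_exists (R : realType) (B : topologicalType)
    (M : set (B -> R)) n (p : B) (f : B -> R) :
  compact [set: B] -> hausdorff_space B -> ~ open [set p] -> (0 < n)%N ->
  haar_space M n -> continuous f -> exists m, is_best_approximant M f m.
Proof.
move=> cB hB np n0 HM cf.
have [_ [e [ind ME]] _] := HM; rewrite ME in HM *.
have [K K0 cK] := haar_coefficient_bound cB hB np n0 HM ind.
pose L (c : 'rV[R]_n) : B -> R := \sum_i c 0 i *: e i.
have cL c : continuous (L c) by apply: (haar_space_continuous HM); exists (c 0).
have cfL c : continuous (f - L c).
  by move=> x; apply: cvgB; [exact: cf|exact: cL].
pose phi c := uniform_norm (f - L c).
pose N := \sum_i uniform_norm (e i).
have ce i : continuous (e i) by apply: (haar_space_continuous HM); exact: linear_span_basis.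
have N0 : 0 <= N by apply: sumr_ge0 => i _; exact: uniform_norm_ge0.
have LB c d : L c - L d = L (c - d).
  rewrite /L -sumrB; apply: eq_bigr => i _; by rewrite -scalerBl !mxE.
have LN c : uniform_norm (L c) <= N * `|c|.
  apply: uniform_norm_le => [|x]; first by rewrite mulr_ge0.
  rewrite /L lincomb_at (le_trans (ler_norm_sum _ _ _))// mulr_suml.
  apply: ler_sum => i _; rewrite normrM mulrC ler_pM// ?ler_uniform_norm//.
  rewrite [leRHS]mx_normrE; exact: (le_bigmax _ (fun ij => `|c ij.1 ij.2|) (0, i)).
(* [phi] is Lipschitz with constant [N] for the maximum norm on coefficients. *)
have phi_lip c d : phi c <= phi d + N * `|c - d|.
  have -> : phi c = uniform_norm ((f - L d) + L (d - c)).
    by rewrite -LB addrA subrK.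
  by rewrite (le_trans (uniform_normD _ _ _))// lerD2l distrC.
have phi_cont : continuous phi.
  move=> c; apply/(@cvgrPdist_le _ _ _ _ (nbhs_filter c)) => eps eps0.
  (* Dividing by [N + 1] avoids a separate argument that [N] is positive. *)
  have N1 : 0 < N + 1 by rewrite ltr_wpDl.
  have : \forall d \near c, `|c - d| <= eps / (N + 1).
    apply/nbhs_normP; exists (eps / (N + 1)); first by rewrite /= divr_gt0.
    by move=> d /ltW.
  apply: filterS => d cd.
  have {cd} Ncd : N * `|c - d| <= eps.
    rewrite (le_trans (ler_wpM2l N0 cd))// mulrCA ler_piMr ?(ltW eps0)//.
    by rewrite ler_pdivrMr// mul1r lerDl.
  have := phi_lip c d; have := phi_lip d c; rewrite (distrC d c) ler_norml.
  by move=> ? ?; apply/andP; split; lra.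
pose r := K * (2 * uniform_norm f).
pose box := [set c : 'rV[R]_n | forall i, [set` `[- r, r]] (c 0 i)].
have r0 : 0 <= r by rewrite !mulr_ge0// uniform_norm_ge0.
have box0 : box 0 by move=> i /=; rewrite mxE in_itv/= oppr_le0 r0.
have cbox : compact box.
  have seg (i : 'I_n) : compact `[- r, r]%classic by exact: segment_compact.
  exact: (rV_compact seg).
have [|c _ cmin] := compact_EVT_min (ex_intro _ _ box0) cbox (f := phi).
  exact: continuous_subspaceT.
exists (L c); split; first by exists (c 0).
move=> _ [d ->].
have dE : \sum_i d i *: e i = L (\row_i d i).
  by apply: eq_bigr => i _; rewrite mxE.
have [dle|dlt] := leP (uniform_norm (L (\row_i d i))) (2 * uniform_norm f).
  rewrite dE; apply: cmin; rewrite inE => i; rewrite mxE /= in_itv/= -ler_norml.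
  by rewrite (le_trans (cK d i))// ler_wpM2l// dE.
have /cmin : 0 \in box by rewrite inE.
rewrite -/(phi c) => /le_trans; apply.
have -> : phi 0 = uniform_norm f.
  rewrite /phi (_ : L 0 = 0) ?subr0//.
  by rewrite /L big1// => i _; rewrite mxE scale0r.
have cLf : continuous (L (\row_i d i) - f).
  by move=> x; apply: cvgB; [exact: cL|exact: cf].
(* The norm of [L d] exceeds twice that of [f], so the triangle inequality puts [L d] at distance at
   least the norm of [f], which is [phi 0]. *)
have := uniform_normD cB cf cLf.
rewrite addrC subrK -(uniform_normN (_ - f)) opprB dE; lra.
Qed.

(** Existence ensures that [best_approximant] is a true minimizer and not the default value, so
    every quotient in the infimum has a nonnegative numerator. *)
Lemma strong_uniqueness_constant_ge0 (R : realType) (B : topologicalType)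
    (M : set (B -> R)) n (p : B) (f : B -> R) :
  compact [set: B] -> hausdorff_space B -> ~ open [set p] -> (0 < n)%N ->
  haar_space M n -> continuous f -> (0 <= strong_uniqueness_constant M f)%E.
Proof.
move=> cB hB np n0 HM cf.
have := xgetPex 0 (haar_best_approximant_exists cB hB np n0 HM cf).
rewrite /strong_uniqueness_constant -/(best_approximant M f) => -[Mms msP].
apply/ereal_infP => _ [m [Mm _] <-].
rewrite lee_fin divr_ge0 ?subr_ge0 ?msP// uniform_norm_ge0// => x.
by apply: cvgB; apply: (haar_space_continuous HM).
Qed.

(** * Construction of a function with a small constant *)

Lemma continuous_clamp (R : realType) (B : topologicalType) (h lo hi : B -> R) :
  continuous h -> continuous lo -> continuous hi ->
  continuous (lo \max (h \min hi)).
Proof.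
move=> ch cl chi x; apply: continuous_max; first exact: cl.
by apply: continuous_min; [exact: ch|exact: chi].
Qed.

(* Equality [uniform_norm (f - m) = 1] forces [lambda x * m x >= 0] on [s];
   since these numbers sum to zero, [m] vanishes on [s]. *)
Lemma best_approximant_eq0 (R : realType) (B : topologicalType)
    (M : set (B -> R)) n (s : seq B) (lambda f : B -> R) :
  compact [set: B] -> haar_space M n -> (0 < n)%N ->
  uniq s -> (n <= size s)%N -> (exists x, x \in s) ->
  (forall m, M m -> \sum_(x <- s) lambda x * m x = 0) ->
  (forall x, x \in s -> lambda x != 0) ->
  continuous f -> uniform_norm f = 1 ->
  (forall x, x \in s -> f x = Num.sg (lambda x)) ->
  best_approximant M f = 0.
Proof.
move=> cB HM n0 us ns [x0 x0s] lamM lam0 cf f1 fs.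
have cfm m : M m -> continuous (f - m).
  by move=> Mm x; apply: cvgB; [exact: cf|exact: (haar_space_continuous HM)].
have key m : M m -> uniform_norm (f - m) <= 1 -> m = 0.
  move=> Mm fm1.
  have pos x : x \in s -> 0 <= lambda x * m x.
    move=> xs; have := le_trans (ler_uniform_norm x cB (cfm m Mm)) fm1.
    have -> : (f - m) x = f x - m x by [].
    rewrite fs// ler_norml => /andP[h1 h2].
    have [l0|l0|l0] := ltgtP (lambda x) 0; last by rewrite l0 mul0r.
    - by rewrite nmulr_rge0//; move: h1; rewrite ltr0_sg//; lra.
    - by rewrite pmulr_rge0//; move: h2; rewrite gtr0_sg//; lra.
  apply: (haar_eq0 HM Mm n0 us ns) => x xs.
  have := lamM m Mm; rewrite big_seq => /eqP; rewrite psumr_eq0// => /allP.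
  by move=> /(_ x xs); rewrite xs /= mulf_eq0 (negPf (lam0 x xs)) => /eqP.
have best0 : is_best_approximant M f 0.
  split; first exact: haar_space_zero HM.
  move=> m Mm; rewrite subr0 f1 leNgt; apply/negP => lt1; move: (lt1).
  by rewrite (key m Mm (ltW lt1)) subr0 f1 ltxx.
(* The choice made by [xget] is [0] once [0] is the only best approximant. *)
apply: xget_subset1 => //.
suff H m : is_best_approximant M f m -> m = 0 by move=> m m' /H -> /H ->.
by case=> Mm /(_ _ (haar_space_zero HM)); rewrite subr0 f1; exact: key.
Qed.

Lemma small_strong_uniqueness_constant (R : realType) (B : topologicalType)
    (M : set (B -> R)) n (p : B) (eps : R) :
  compact [set: B] -> hausdorff_space B -> ~ open [set p] -> (2 <= n)%N ->
  haar_space M n -> 0 < eps ->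
  exists f, [/\ continuous f, uniform_norm f = 1 &
    (strong_uniqueness_constant M f <= eps%:E)%E].
Proof.
move=> cB hB np n2 HM eps0.
have n0 : (0 < n)%N by exact: leq_trans n2.
(* With [p] these are [n - 1] points, the largest number of zeros that a nonzero element of [M] may
   have. *)
have [t [ut st]] := uniq_seq_of_size n.-2 hB np (isT : uniq [:: p]).
have stp : size (t ++ [:: p]) = n.-1.
  by rewrite size_cat st addn1; case: (n) n2 => [|[]].
set tp := t ++ [:: p] in stp ut.
have [|m0 [Mm0 m00 m0t]] := @haar_space_vanishing _ _ _ _ tp HM; first by rewrite stp prednK.
have cm0 := haar_space_continuous HM Mm0.
have N0 := uniform_norm_gt0 cB cm0 m00.
have m0p : m0 p = 0 by apply: m0t; rewrite mem_cat inE eqxx orbT.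
have near_p : nbhs p [set y | `|m0 y| <= eps * uniform_norm m0].
  have : m0 @ p --> m0 p by exact: cm0.
  move=> /cvgrPdist_le/(_ _ (mulr_gt0 eps0 N0)).
  by apply: filterS => y /=; rewrite m0p sub0r normrN.
have [y ysmall yt] := nbhs_fresh_point tp hB np near_p.
have [z _ zt] := nbhs_fresh_point (y :: tp) hB np filterT.
pose s := z :: y :: tp.
have us : uniq s by rewrite /s cons_uniq zt cons_uniq yt.
have ss : size s = n.+1 by rewrite /s /= stp prednK.
have [lambda [lamM lam0]] := haar_annihilator HM n0 us ss.
have sg1 x : x \in s -> `|Num.sg (lambda x)| = 1.
  by move=> /lam0 lx; rewrite normr_sg lx.
have [m [Mm mn0 [mN mz my mt]]] : exists m, [/\ M m, m <> 0 &
    [/\ uniform_norm m = 1, 0 <= Num.sg (lambda z) * m z, `|m y| <= eps &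
        forall x, x \in tp -> m x = 0]].
  (* The sign [b] makes the values of [m] and [lambda] at [z] agree in sign; [z] is the only node
     where [m] is not known to be small. *)
  have [b b1 bz] : exists2 b, `|b| = 1 & 0 <= Num.sg (lambda z) * (b * m0 z).
    have [le0|lt0] := leP 0 (Num.sg (lambda z) * m0 z).
      by exists 1; rewrite ?normr1// mul1r.
    by exists (-1); rewrite ?normrN1// mulN1r mulrN oppr_ge0 ltW.
  have a0 : b / uniform_norm m0 != 0.
    by rewrite mulf_neq0 ?invr_eq0 ?(gt_eqF N0)// -normr_eq0 b1 oner_eq0.
  have ab : `|b / uniform_norm m0| = (uniform_norm m0)^-1.
    by rewrite normrM b1 mul1r gtr0_norm ?invr_gt0.
  have aE x : ((b / uniform_norm m0) *: m0) x = b / uniform_norm m0 * m0 x by [].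
  exists ((b / uniform_norm m0) *: m0); split.
  - exact: haar_space_scale HM Mm0.
  - by move/eqP; rewrite scaler_eq0 (negPf a0) => /eqP.
  - split.
    + by rewrite uniform_normZ// ab mulVf// gt_eqF.
    + rewrite aE (mulrAC b) mulrA divr_ge0// ?(ltW N0)//.
    + by rewrite aE normrM ab mulrC ler_pdivrMr.
    + by move=> x xt; rewrite aE m0t// mulr0.
have cm := haar_space_continuous HM Mm.
have mle x : `|m x| <= 1 by rewrite -mN ler_uniform_norm.
have [h [ch hs]] := continuous_sign_interpolation cB hB sg1.
(* Lying between [lo] and [hi] amounts to [|f| <= 1] together with [|f - m| <= 1 + eps]. *)
pose lo x := Num.max (-1) (m x - 1 - eps).
pose hi x := Num.min 1 (m x + 1 + eps).
pose f : B -> R := lo \max (h \min hi).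
have cf : continuous f.
  apply: continuous_clamp => // x.
  - apply: (@continuous_max _ _ (fun=> -1) (fun x => m x - 1 - eps)).
      exact: cvg_cst.
    by do 2?[apply: cvgB; last exact: cvg_cst]; exact: cm.
  - apply: (@continuous_min _ _ (fun=> 1) (fun x => m x + 1 + eps)).
      exact: cvg_cst.
    by do 2?[apply: cvgD; last exact: cvg_cst]; exact: cm.
have fs x : x \in s -> f x = Num.sg (lambda x).
  move=> xs; have := hs x xs; have := lam0 x xs.
  have := mle x; rewrite ler_norml => /andP[m_ge m_le] lx hx.
  (* Clamping leaves the nodes untouched: at [z] by the choice of sign, at [y] because
     [|m y| <= eps], on [tp] because [m] vanishes there. *)
  have [lox hix] : lo x <= Num.sg (lambda x) /\ Num.sg (lambda x) <= hi x.
    rewrite /lo /hi ge_max le_min; move: xs; rewrite !inE => /or3P[/eqP xz|/eqP xy|xt].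
    - move: mz; rewrite -xz; case: sgrP lx => // _ _ ?; split; apply/andP; split; lra.
    - move: my; rewrite -xy ler_norml => /andP[? ?].
      by case: sgrP lx => // _ _; split; apply/andP; split; lra.
    - by rewrite mt//; case: sgrP lx => // _ _; split; apply/andP; split; lra.
  by rewrite /f /= hx min_l// max_r.
(* The bounds are compatible, [lo <= hi], because [|m| <= 1]. *)
have f_le x : [/\ -1 <= f x, f x <= 1, m x - 1 - eps <= f x & f x <= m x + 1 + eps].
  have := mle x; rewrite ler_norml => /andP[m_ge m_le].
  rewrite /f /lo /hi /= !le_max !ge_max !ge_min !lexx !orbT !andbT.
  by split=> //; repeat (apply/andP; split); lra.
have f1 : uniform_norm f = 1.
  apply/eqP; rewrite eq_le; apply/andP; split.
    by apply: uniform_norm_le => // x; have [? ? _ _] := f_le x; rewrite ler_norml; apply/andP.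
  have zs : z \in s by rewrite inE eqxx.
  by rewrite -(sg1 z zs) -fs// ler_uniform_norm.
exists f; split => //.
rewrite /strong_uniqueness_constant.
rewrite (best_approximant_eq0 cB HM n0 us _ _ lamM lam0 cf f1 fs); last 2 first.
- by rewrite ss.
- by exists z; rewrite inE eqxx.
(* The quotient at [m] alone bounds the infimum; its denominator is the norm of [m], equal to
   [1]. *)
apply: (@le_trans _ _ ((uniform_norm (f - m) - 1) / 1)%:E).
  by apply: ereal_inf_lbound; exists m => //; rewrite !subr0 f1 mN.
rewrite lee_fin divr1 lerBlDl; apply: uniform_norm_le => [|x].
  by rewrite addr_ge0// ltW.
have -> : (f - m) x = f x - m x by [].
by have [_ _ ? ?] := f_le x; rewrite ler_norml; apply/andP; split; lra.
Qed.

Theorem proposition4p8 (R : realType) (B : topologicalType)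
    (B_compact : compact [set: B]) (B_hausdorff : hausdorff_space B)
    (B_not_discrete : ~ is_discrete B)
    (M : set (B -> R)) (n : nat) (n_ge2 : (2 <= n)%N)
    (M_haar : haar_space M n) :
  ereal_inf [set strong_uniqueness_constant M f | f in
      [set f | continuous_functions R B f /\ uniform_norm f = 1]] = 0%E.
Proof.
have [p np] := non_isolated_point B_not_discrete.
(* The upper bound is obtained up to every positive [eps]; the lower bound is the nonnegativity of
   each constant. *)
apply/eqP; rewrite eq_le; apply/andP; split.
  apply/lee_addgt0Pr => eps eps0; rewrite add0e.
  have [f [cf f1 fle]] :=
    small_strong_uniqueness_constant B_compact B_hausdorff np n_ge2 M_haar eps0.
  by apply: le_trans fle; apply: ereal_inf_lbound; exists f.
apply/ereal_infP => _ [f [cf _] <-].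
apply: (strong_uniqueness_constant_ge0 B_compact B_hausdorff np _ M_haar cf).
exact: leq_trans n_ge2.
Qed.
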